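(* Let $A,B,C$ be real matrices of sizes $n\times n$, $n\times r$, $l\times n$ with $l>r$, $\operatorname{rank}B=r$, $(A,B)$ controllable with controllability index $\nu$, and suppose $P(s)=\begin{bmatrix} sI_n-A & -B \\ C & O \end{bmatrix}$ has normal rank $n+r$. Let $\tilde C(s)=[O,C_1]+[O,C_2]s+\cdots+[O,C_{\nu-1}]s^{\nu-2}+C_\nu s^{\nu-1}$ be the $l\times r$ matrix polynomial obtained from the Yokoyama canonical form as in the context. Then the system zeros of $\dot x=Ax+Bu$, $y=Cx$ coincide with the zeros of the polynomial $\psi(s)$ that is the greatest common divisor of all the not identically zero polynomials $s^{\,n-r\nu}\,\tilde C(s)^{i_1,\dots,i_r}$, $1\le i_1<\cdots<i_r\le l$, where $\tilde C(s)^{i_1,\dots,i_r}$ is the order-$r$ minor of $\tilde C(s)$ formed by rows $i_1,\dots,i_r$.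
   Context: Controllability index: the smallest $\nu$ with $\operatorname{rank}[B,AB,\dots,A^{\nu-1}B]=\operatorname{rank}[B,\dots,A^{n-1}B]$. Integers $l_1\le\cdots\le l_\nu=r$ are defined by $l_\nu=\operatorname{rank}B$ and $l_{\nu-k}=\operatorname{rank}[B,\dots,A^{k}B]-\operatorname{rank}[B,\dots,A^{k-1}B]$, $k=1,\dots,\nu-1$; then $l_1+\cdots+l_\nu=n$. Yokoyama canonical form: there are a nonsingular $n\times n$ matrix $N$ and an $r\times r$ permutation matrix $M$ such that $$NAN^{-1}=\begin{bmatrix} O & E_{1,2} & O & \cdots & O \\ O & O & E_{2,3} & \cdots & O \\ \vdots & & & \ddots & \vdots \\ O & O & O & \cdots & E_{\nu-1,\nu} \\ F_{\nu 1} & F_{\nu 2} & F_{\nu 3} & \cdots & F_{\nu\nu} \end{bmatrix},\qquad NBM=\begin{bmatrix} O \\ G_\nu \end{bmatrix},$$ with block sizes $l_1,\dots,l_\nu$, $E_{i,i+1}=[O,I_{l_i}]$ of size $l_i\times l_{i+1}$, and $G_\nu$ an $r\times r$ lower triangular matrix with unit diagonal. Fix such $N,M$ and partition $CN^{-1}=[C_1,\dots,C_\nu]$ with $C_i$ of size $l\times l_i$. $[O,C_i]$ denotes $C_i$ padded on the left by zero columns to have $r$ columns. System zeros: among the minors of $P(s)$ formed by rows $1,\dots,n,n+i_1,\dots,n+i_k$ and columns $1,\dots,n,n+j_1,\dots,n+j_k$, take those of the largest order that are not identically zero; the system zeros are the zeros of their greatest common divisor. *)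

(* Defs.v *)
From HB Require Import structures.
From mathcomp Require Import all_boot all_order all_algebra.
From mathcomp Require Import reals.
From mathcomp Require Import complex.

Set Implicit Arguments.
Unset Strict Implicit.
Unset Printing Implicit Defensive.

Import Order.TTheory GRing.Theory Num.Theory.
Local Open Scope ring_scope.

Section Controllability.
Variables (F : fieldType) (n r : nat) (A : 'M[F]_n) (B : 'M[F]_(n, r)).

(* [B, A B, ..., A^(k-1) B] *)
Definition ctrb (k : nat) : 'M[F]_(n, \sum_(j < k) r) :=
  \mxrow_(j < k) (A ^+ j *m B).

Definition controllable : Prop := \rank (ctrb n) = n.

(* The requirement 0 < nu only matters when n = 0: it reads
   [B, ..., A^(nu-1) B] as having at least the block B. *)
Definition ctrb_index (nu : nat) : Prop :=
  [/\ (0 < nu)%N, \rank (ctrb nu) = \rank (ctrb n)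
    & forall k, (0 < k)%N -> \rank (ctrb k) = \rank (ctrb n) -> (nu <= k)%N].

(* l_(nu - k) in 1-based indexing *)
Definition rank_step (k : nat) : nat :=
  if k is 0 then \rank B else (\rank (ctrb k.+1) - \rank (ctrb k))%N.

(* Blocks are indexed from 0, so block_size nu i is l_(i+1). *)
Definition block_size (nu : nat) (i : 'I_nu) : nat := rank_step (nu.-1 - i).

Lemma rank_ctrb k :
  \rank (ctrb k) = \rank (\sum_(j < k) <<(A ^+ j *m B)^T>>)%MS.
Proof. by rewrite -mxrank_tr tr_mxrow (eqmx_col _). Qed.

Lemma rank_ctrbS k : (\rank (ctrb k) <= \rank (ctrb k.+1))%N.
Proof. by rewrite !rank_ctrb big_ord_recr mxrankS ?addsmxSl. Qed.

Lemma rank_ctrb1 : \rank (ctrb 1) = \rank B.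
Proof.
by rewrite rank_ctrb big_ord1 mxrank_gen expr0 mul1mx mxrank_tr.
Qed.

Lemma sum_rank_step k : (\sum_(i < k.+1) rank_step i)%N = \rank (ctrb k.+1).
Proof.
elim: k => [|k IHk]; first by rewrite big_ord1 rank_ctrb1.
by rewrite big_ord_recr /= IHk subnKC ?rank_ctrbS.
Qed.

Lemma sum_block_size (nu : nat) :
  controllable -> ctrb_index nu -> (\sum_(i < nu) block_size i)%N = n.
Proof.
move=> ctrAB [nu_gt0 rk_nu _]; rewrite -[RHS]ctrAB -rk_nu.
case: nu nu_gt0 {rk_nu} => // k _.
rewrite -sum_rank_step (reindex_inj rev_ord_inj) /=.
by apply: eq_bigr => i _; rewrite /block_size /= subKn // -ltnS.
Qed.

End Controllability.

(* [O, X] with q columns and [O; X] with q rows; junk value 0 if X is too big. *)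
Definition lpad_mx (R : nmodType) (m p : nat) (q : nat) (X : 'M[R]_(m, p)) :
  'M[R]_(m, q) := conform_mx 0 (row_mx (0 : 'M[R]_(m, q - p)) X).
Definition upad_mx (R : nmodType) (m p : nat) (q : nat) (X : 'M[R]_(m, p)) :
  'M[R]_(q, p) := conform_mx 0 (col_mx (0 : 'M[R]_(q - m, p)) X).

Section Yokoyama.
Variables (F : fieldType) (n r l nu : nat).
Variables (A : 'M[F]_n) (B : 'M[F]_(n, r)) (C : 'M[F]_(l, n)).
Variable (e : (\sum_(i < nu) block_size A B i)%N = n).

(* The last block row F_(nu,1), ..., F_(nu,nu) is arbitrary, hence
   unconstrained below. *)
Definition yokoyama_form (N : 'M[F]_n) (M : 'M[F]_r) : Prop :=
  [/\ N \in unitmx,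
      is_perm_mx M,
      forall i j : 'I_nu, (i.+1 < nu)%N ->
        submxblock (castmx (esym e, esym e) (N *m A *m invmx N)) i j
        = if (j == i.+1 :> nat) then lpad_mx _ 1%:M else 0
    & exists G : 'M[F]_r,
        [/\ is_trig_mx G, forall i, G i i = 1 & N *m B *m M = upad_mx n G]].

Definition C_block (N : 'M[F]_n) (i : 'I_nu) : 'M[F]_(l, block_size A B i) :=
  submxrow (castmx (erefl l, esym e) (C *m invmx N)) i.

Definition C_tilde (N : 'M[F]_n) : 'M[{poly F}]_(l, r) :=
  \sum_(i < nu) 'X^i *: map_mx polyC (lpad_mx r (C_block N i)).

End Yokoyama.

Definition incr_ffun (k m : nat) (f : {ffun 'I_k -> 'I_m}) : bool :=
  [forall i : 'I_k, forall j : 'I_k, (i < j)%N ==> (f i < f j)%N].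

Section SystemZeros.
Variables (F : fieldType) (n r l : nat).
Variables (A : 'M[F]_n) (B : 'M[F]_(n, r)) (C : 'M[F]_(l, n)).

Definition system_matrix : 'M[{poly F}]_(n + l, n + r) :=
  block_mx ('X%:M - map_mx polyC A) (- map_mx polyC B) (map_mx polyC C) 0.

(* rank over the field F(s) of rational functions *)
Definition normal_rank (p q : nat) (P : 'M[{poly F}]_(p, q)) : nat :=
  \rank (map_mx (@tofrac {poly F}) P).

(* The indices 1, ..., n, n + f_1, ..., n + f_k *)
Definition extend_index (k m : nat) (f : {ffun 'I_k -> 'I_m}) (i : 'I_(n + k)) :
  'I_(n + m) :=
  match split i with inl a => lshift m a | inr b => rshift n (f b) end.

Definition system_minor (k : nat) (f : {ffun 'I_k -> 'I_l})
  (g : {ffun 'I_k -> 'I_r}) : {poly F} :=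
  \det (mxsub (extend_index f) (extend_index g) system_matrix).

Definition has_system_minor (k : nat) : bool :=
  [exists f : {ffun 'I_k -> 'I_l}, exists g : {ffun 'I_k -> 'I_r},
    [&& incr_ffun f, incr_ffun g & system_minor f g != 0]].

(* The largest order of a nonzero minor is n + max_minor_order. *)
Definition max_minor_order : nat :=
  \max_(k < (minn l r).+1 | has_system_minor k) k.

Definition system_zero_poly : {poly F} :=
  \big[@gcdp F/0]_(fg : {ffun 'I_max_minor_order -> 'I_l} *
                        {ffun 'I_max_minor_order -> 'I_r}
      | [&& incr_ffun fg.1, incr_ffun fg.2 & system_minor fg.1 fg.2 != 0])
    system_minor fg.1 fg.2.

End SystemZeros.

(* Complex zeros of real polynomials, counted with multiplicity *)
Definition same_zeros (R : realType) (p q : {poly R}) : Prop :=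
  forall z : R[i],
    root (map_poly (real_complex R) p) z = root (map_poly (real_complex R) q) z
    /\ mup z (map_poly (real_complex R) p) = mup z (map_poly (real_complex R) q).

(* Main.v *)
(* In Yokoyama coordinates A = S + D K, where S is the block shift made of the
   E_(i,i+1), D = [O; I_r] and K is the last block row of A. The feedback
   killing K is a unimodular column operation on P(s), and the remaining pencil
   sI - S has determinant s^n. The matrix V(s) with block rows s^(i-1) [O, I_(l_i)]
   satisfies (sI - S) V = s^nu D and C V = C~(s). A second column operation
   with V, of determinant s^(r nu), therefore turns the minor of P(s) with all
   inputs and output rows f into s^n det C~_f. Normal rank n + r forces
   the largest nonzero minors to use all r inputs, so up to the sign det M the
   two families of polynomials, hence their gcds, agree. *)

Require Import Defs.
From HB Require Import structures.
From mathcomp Require Import all_boot all_order all_algebra.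
From mathcomp Require Import reals.
From mathcomp Require Import complex.
From mathcomp Require Import zify ring.
Set Implicit Arguments.
Unset Strict Implicit.
Unset Printing Implicit Defensive.
Import Order.TTheory GRing.Theory Num.Theory.
Local Open Scope ring_scope.

(** * Calculus of the padding blocks [O, I] *)

Section RightSelection.
Variable R : pzSemiRingType.

(* The block [O, I_p], written without the truncated subtraction q - p. *)
Definition rsel_mx p q : 'M[R]_(p, q) := \matrix_(i, j) (j + p == i + q)%N%:R.

Lemma rsel_mx_id p : rsel_mx p p = 1%:M.
Proof. by apply/matrixP => i j; rewrite !mxE eqn_add2r eq_sym. Qed.

Lemma lpad_mxE m p q (X : 'M[R]_(m, p)) :
  (p <= q)%N -> lpad_mx q X = X *m rsel_mx p q.
Proof.
move=> le_pq; rewrite /lpad_mx.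
move: (q - p)%N (subnK le_pq) => d; move: q {le_pq} => q eq_q; case: q / eq_q.
rewrite conform_mx_id; apply/matrixP => a j; rewrite !mxE.
case: splitP => [k eq_jk | k eq_jk]; rewrite ?mxE.
  rewrite big1 // => i _; rewrite mxE eq_jk addnA eqn_add2r.
  by rewrite ltn_eqF ?mulr0 // ltn_addl.
rewrite (bigD1 k) //= big1 ?addr0 => [|i ne_ik]; rewrite mxE eq_jk addnA.
  by rewrite [(d + k)%N]addnC eqxx mulr1.
by rewrite eqn_add2r addnC eqn_add2r eq_sym val_eqE (negPf ne_ik) mulr0.
Qed.

Lemma mul_rsel_mx p q t :
  (p <= q)%N -> (q <= t)%N -> rsel_mx p q *m rsel_mx q t = rsel_mx p t.
Proof.
move=> le_pq le_qt; apply/matrixP => i j; rewrite !mxE.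
(* Row [i] of [rsel_mx p q] has its single 1 in column [i + (q - p)]. *)
have lt_k : (i + (q - p) < q)%N.
  by rewrite -{2}(subnKC le_pq) ltn_add2r.
rewrite (bigD1 (Ordinal lt_k)) //= big1 ?addr0 => [|k ne_k]; rewrite !mxE /=.
  rewrite -addnA subnK // eqxx mul1r -(eqn_add2r p) addnAC.
  rewrite -[in RHS](eqn_add2r q); congr (_ == _)%:R.
  by rewrite -!addnA [(t + p)%N]addnC [(q - p + _)%N]addnA subnK // [(q + t)%N]addnC.
rewrite (_ : (k + p == i + q)%N = false) ?mul0r //.
apply: contraNF ne_k => /eqP eq_k; apply/eqP/val_inj => /=.
by rewrite addnBA // -eq_k addnK.
Qed.

End RightSelection.
Arguments rsel_mx {R} p q.

Lemma map_rsel_mx (R S : pzSemiRingType) (g : {rmorphism R -> S}) p q :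
  map_mx g (rsel_mx p q) = rsel_mx p q.
Proof. by apply/matrixP => i j; rewrite !mxE rmorph_nat. Qed.

Lemma upad_mxE (R : comPzSemiRingType) m p q (X : 'M[R]_(m, p)) :
  (m <= q)%N -> upad_mx q X = (rsel_mx m q)^T *m X.
Proof.
move=> le_mq; apply: trmx_inj; rewrite trmx_mul trmxK -lpad_mxE //.
by rewrite /upad_mx /lpad_mx trmx_conform tr_col_mx !trmx0.
Qed.

(** * The block shift, its pencil and feedback *)

Section Companion.
Variables (F : fieldType) (nu : nat) (sz : 'I_nu.+1 -> nat).
Hypothesis sz_mono : forall i j : 'I_nu.+1, (i <= j)%N -> (sz i <= sz j)%N.

Local Notation n := (\sum_i sz i)%N.
Local Notation r := (sz ord_max).

(** This is the input matrix D. Its last block is written [rsel_mx (sz i) r] rather than [1%:M]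
    because [sz i] and [r] agree only once [i] is replaced by [ord_max]. *)
Lemma rsel_trE (R : pzSemiRingType) :
  (rsel_mx r n)^T = \mxcol_i (if i == ord_max then rsel_mx (sz i) r else 0)
    :> 'M[R]_(n, r).
Proof.
apply/matrixP => a b; rewrite !mxE.
have -> : (a : nat) = (\sum_(k < nu.+1 | (k < tagnat.sig1 a)%N) sz k
                       + tagnat.sig2 a)%N.
  exact: tagnat.rect.
have sum_n : n = (\sum_(k < nu.+1 | (k < nu)%N) sz k + r)%N.
  rewrite [in LHS](bigD1 ord_max) //= addnC; congr addn; apply: eq_bigl => k.
  by rewrite -val_eqE /= ltn_neqAle -ltnS ltn_ord andbT.
move: (tagnat.sig1 a) (tagnat.sig2 a) => i c.
have [eq_i|ne_i] := eqVneq i ord_max.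
  move: c; rewrite eq_i => c; rewrite mxE sum_n /=.
  by rewrite addnCA -[(_ + c + _)%N]addnA eqn_add2l eq_sym.
rewrite mxE; have lt_inu : (i < nu)%N.
  by rewrite ltn_neqAle -ltnS ltn_ord andbT; move: ne_i; rewrite -val_eqE.
rewrite [_ == _]ltn_eqF // ltn_addl // sum_n ltn_add2r.
rewrite [X in (_ < X)%N](bigD1 i) //= [X in (_ < X)%N]addnC -addnS leq_add //.
rewrite [X in (X <= _)%N]big_mkcond [X in (_ <= X)%N]big_mkcond leq_sum // => k _.
case: ltnP => // lt_ki; rewrite (ltn_trans lt_ki lt_inu) -val_eqE /=.
by rewrite ltn_eqF.
Qed.

Definition shift_mx : 'M[F]_n :=
  \mxblock_(i, j) (if j == i.+1 :> nat then rsel_mx (sz i) (sz j) else 0).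

Definition power_mx : 'M[{poly F}]_(n, r) :=
  \mxcol_i ('X^i *: rsel_mx (sz i) r).

(** The blocks of S lie strictly above the diagonal, so sI - S is upper triangular with diagonal s;
    the transpose brings it to the lower triangular form of [is_trig_mx]. *)
Lemma det_X_sub_shift : \det ('X%:M - map_mx polyC shift_mx) = 'X^n.
Proof.
rewrite -det_tr det_trig.
  rewrite (eq_bigr (fun _ => 'X)) ?prodr_const ?card_ord // => a _.
  by rewrite !mxE eqxx ltn_eqF ?ltnSn // mxE subr0.
apply/is_trig_mxP => b a lt_ba; rewrite !mxE -val_eqE gtn_eqF // mulr0n sub0r.
case: eqP => [eq_ba|_]; last by rewrite mxE oppr0.
have : (tagnat.sig1 b <= tagnat.sig1 a)%O by rewrite tagnat.le_sig1 ?leEord // ltnW.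
by rewrite leEord eq_ba ltnn.
Qed.

(** In every block row but the last, s s^i [O, I] cancels against the shifted s^(i+1) [O, I], since
    consecutive paddings compose. The last row keeps s s^nu, the number of blocks being [nu.+1]
    here. *)
Lemma X_sub_shift_power :
  ('X%:M - map_mx polyC shift_mx) *m power_mx = 'X^(nu.+1) *: (rsel_mx r n)^T.
Proof.
have -> : map_mx polyC shift_mx =
    \mxblock_(i, j) (if j == i.+1 :> nat then rsel_mx (sz i) (sz j) else 0)
      :> 'M[{poly F}]_n.
  by apply/matrixP=> a b; rewrite !mxE; case: ifP; rewrite !mxE ?rmorph_nat.
rewrite mulmxBl mul_scalar_mx mul_mxblock_mxrow.
rewrite rsel_trE /power_mx; apply/mxcolP => i.
have submxcolZ m a (Y : 'M[{poly F}]_(n, m)) :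
    submxcol (a *: Y) i = a *: submxcol Y i.
  by apply/matrixP => ? ?; rewrite !mxE.
rewrite submxcolB !submxcolZ !mxcolK scalerA -exprS.
have [->|ne_i] := eqVneq i ord_max.
  rewrite big1 ?subr0 // => j _.
  by rewrite ltn_eqF ?mul0mx.
have lt_i : (i.+1 < nu.+1)%N.
  by rewrite ltn_neqAle ltn_ord andbT eqSS; move: ne_i; rewrite -val_eqE.
rewrite (bigD1 (Ordinal lt_i)) //= eqxx big1 ?addr0 => [|j ne_j].
  by rewrite -scalemxAr mul_rsel_mx ?sz_mono // ?leqnSn -?ltnS // subrr scaler0.
by rewrite ifN ?mul0mx // -[i.+1]/(val (Ordinal lt_i)) val_eqE.
Qed.

Lemma companion_decomposition (A : 'M[F]_n) :
    (forall i j : 'I_nu.+1, (i.+1 < nu.+1)%N ->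
      submxblock A i j = if (j == i.+1 :> nat) then lpad_mx _ 1%:M else 0) ->
  A = shift_mx + (rsel_mx r n)^T *m submxcol A ord_max.
Proof.
move=> A_blocks; apply/mxblockP => i j.
rewrite submxblockD mxblockK [in X in _ + X]submxblockEv -submxcol_mul rsel_trE mxcolK.
have [->|ne_i] := eqVneq i ord_max.
  by rewrite ltn_eqF // add0r rsel_mx_id mul1mx -submxblockEv.
have lt_i : (i.+1 < nu.+1)%N.
  by rewrite ltn_neqAle ltn_ord andbT eqSS; move: ne_i; rewrite -val_eqE.
rewrite A_blocks // mul0mx [submxrow 0 j](_ : _ = 0) ?addr0; last first.
  by apply/matrixP => ? ?; rewrite !mxE.
by case: eqP => // eq_j; rewrite lpad_mxE ?mul1mx // sz_mono // eq_j.
Qed.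

Lemma mul_power_mx m (C : 'M[F]_(m, n)) :
  \sum_(i < nu.+1) 'X^i *: map_mx polyC (lpad_mx r (submxrow C i))
  = map_mx polyC C *m power_mx.
Proof.
rewrite -[in RHS](submxrowK C).
have -> : map_mx polyC (\mxrow_j submxrow C j) = \mxrow_j map_mx polyC (submxrow C j).
  by apply/matrixP => a b; rewrite !mxE.
rewrite mul_mxrow_mxcol; apply: eq_bigr => i _.
by rewrite lpad_mxE ?sz_mono ?leq_ord // map_mxM map_rsel_mx scalemxAr.
Qed.

End Companion.

Lemma det_feedback (F : fieldType) n r (A S : 'M[F]_n) (D : 'M[F]_(n, r))
    (K : 'M[F]_(r, n)) (G : 'M[F]_r) (C : 'M[F]_(r, n))
    (V : 'M[{poly F}]_(n, r)) (p : {poly F}) :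
    A = S + D *m K -> \det G = 1 ->
    ('X%:M - map_mx polyC S) *m V = p *: map_mx polyC D ->
  \det (block_mx ('X%:M - map_mx polyC A) (- map_mx polyC (D *m G))
                 (map_mx polyC C) 0) * p ^+ r
  = \det ('X%:M - map_mx polyC S) * \det (map_mx polyC C *m V).
Proof.
move=> defA detG SV.
have Gunit : G \in unitmx by rewrite unitmxE detG unitr1.
(* [Y] is the feedback that removes K through the input matrix D G. [W] is chosen so that D G W = p
   D, which cancels (sI - S) V in the upper right block. *)
pose Y := map_mx polyC (invmx G *m K); pose W := p *: map_mx polyC (invmx G).
have DGY : map_mx polyC (D *m G) *m Y = map_mx polyC (D *m K).
  by rewrite -map_mxM mulmxA mulmxK.
have DGW : map_mx polyC (D *m G) *m W = p *: map_mx polyC D.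
  by rewrite -scalemxAr -map_mxM mulmxK.
have SE : 'X%:M - map_mx polyC A = 'X%:M - map_mx polyC S - map_mx polyC (D *m K).
  by rewrite defA map_mxD opprD addrA.
have detW : \det W = p ^+ r.
  by rewrite detZ det_map_mx det_inv detG invr1 mulr1.
set P := block_mx _ _ _ _; set C' := map_mx polyC C in P *.
have PE : P *m block_mx 1%:M 0 (- Y) 1%:M *m block_mx 1%:M V 0 W
          = block_mx ('X%:M - map_mx polyC S) 0 C' (C' *m V).
  rewrite !mulmx_block !mulmx1 !mulmx0 !mul0mx ?addr0 ?add0r.
  rewrite mulNmx mulmxN opprK DGY SE subrK SV mulNmx DGW subrr.
  by rewrite mul0mx addr0.
have := congr1 determinant PE; rewrite !det_mulmx det_lblock det_ublock det_lblock.
by rewrite !det1 !mulr1 mul1r detW.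
Qed.

Lemma companion_minor (F : fieldType) nu (sz : 'I_nu.+1 -> nat) n r
    (e : (\sum_i sz i)%N = n) (A : 'M[F]_n) (G : 'M[F]_r) (C : 'M[F]_(r, n)) :
    (forall i j : 'I_nu.+1, (i <= j)%N -> (sz i <= sz j)%N) ->
    sz ord_max = r ->
    (forall i j : 'I_nu.+1, (i.+1 < nu.+1)%N ->
      submxblock (castmx (esym e, esym e) A) i j
      = if (j == i.+1 :> nat) then lpad_mx _ 1%:M else 0) ->
    \det G = 1 ->
  \det (block_mx ('X%:M - map_mx polyC A) (- map_mx polyC (upad_mx n G))
                 (map_mx polyC C) 0) * 'X^(r * nu.+1)
  = 'X^n * \det (\sum_(i < nu.+1) 'X^i *: map_mx polyC
                   (lpad_mx r (submxrow (castmx (erefl r, esym e) C) i))).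
Proof.
move=> sz_mono eq_r; case: r / eq_r in G C *.
case: n / e in A C * => /=; rewrite !castmx_id => A_blocks detG.
rewrite mul_power_mx // -det_X_sub_shift upad_mxE; last first.
  by rewrite (bigD1 ord_max) //= leq_addr.
rewrite mulnC exprM; apply: (det_feedback _ (companion_decomposition sz_mono A_blocks) detG).
by rewrite X_sub_shift_power // -map_trmx map_rsel_mx.
Qed.

(** * Monotonicity of the block sizes *)

Section Controllability.
Variables (F : fieldType) (n r : nat) (A : 'M[F]_n) (B : 'M[F]_(n, r)).

Local Notation rho k := (\rank (ctrb A B k)).

(* With W_j the column space of [B, ..., A^(j-1) B], A induces a surjection from
   W_(k+1)/W_k onto W_(k+2)/W_(k+1); everything is transposed because mxalgebra
   works with row spaces. *)
Lemma rank_ctrb_concave k : (rho k.+2 + rho k <= (rho k.+1).*2)%N.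
Proof.
pose S j := (\sum_(i < j) <<(A ^+ i *m B)^T>>)%MS.
have SS j : (S j.+1 == <<B^T>> + S j *m A^T)%MS.
  apply/eqmxP; rewrite /S big_ord_recl expr0 mul1mx.
  apply: adds_eqmx => //; apply: eqmx_sym; apply: eqmx_trans (sumsmxMr _ _ _) _.
  apply: eqmx_sums => i _; apply: eqmx_trans (eqmxMr _ (genmxE _)) _.
  apply: eqmx_sym; apply: eqmx_trans (genmxE _) _.
  rewrite lift0 exprS -[A * _]/(A *m _) -mulmxA trmx_mul.
  exact: eqmx_refl.
have S_step j : (S j <= S j.+1)%MS by rewrite /S big_ord_recr addsmxSl.
rewrite !rank_ctrb -/(S k) -/(S k.+1) -/(S k.+2).
(* [D] represents the quotient W_(k+1)/W_k. *)
pose D := (S k.+1 :\: S k)%MS.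
have rkD : (\rank (S k) + \rank D = \rank (S k.+1))%N.
  by rewrite -(mxrank_cap_compl (S k.+1) (S k)) (capmx_idPr (S_step k)).
(* A maps W_k into W_(k+1), so only the image of [D] can be new in W_(k+2). *)
have le_S : (S k.+2 <= S k.+1 + D *m A^T)%MS.
  rewrite (eqmxP (SS k.+1)) addsmx_sub; apply/andP; split.
    by rewrite (submx_trans _ (addsmxSl _ _)) // (eqmxP (SS k)) addsmxSl.
  have : (S k.+1 <= S k + D)%MS.
    rewrite -{1}(addsmx_diff_cap_eq (S k.+1) (S k)) addsmxC addsmxS //.
    by rewrite capmxSr.
  move/(submxMr A^T)/submx_trans; apply; rewrite addsmxMr addsmxS //.
  by rewrite (eqmxP (SS k)) addsmxSr.
rewrite -addnn -{2}rkD addnCA addnC leq_add2l.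
rewrite (leq_trans (mxrankS le_S)) // (leq_trans (mxrank_adds_leqif _ _)) //.
by rewrite leq_add2l mxrankM_maxl.
Qed.

(** As [ctrb 0] has rank 0, the special value at index 0 fits the difference formula too, and
    concavity applies to every step. *)
Lemma rank_stepE k : rank_step A B k = (rho k.+1 - rho k)%N.
Proof.
case: k => [|k] //=; rewrite -(rank_ctrb1 A B) [X in (_ - X)%N]rank_ctrb big_ord0.
by rewrite mxrank0 subn0.
Qed.

Lemma rank_step_decr i j : (i <= j)%N -> (rank_step A B j <= rank_step A B i)%N.
Proof.
move=> /subnKC <-; elim: (j - i)%N => [|d IHd]; first by rewrite addn0.
apply: leq_trans IHd; rewrite addnS !rank_stepE.
have := rank_ctrb_concave (i + d); have := rank_ctrbS A B (i + d).
lia.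
Qed.

(** The order flips because blocks read the rank steps backwards. This keeps the blocks [O, I] of
    the canonical form away from the junk value of [lpad_mx]. *)
Lemma block_size_mono nu (i j : 'I_nu) :
  (i <= j)%N -> (block_size A B i <= block_size A B j)%N.
Proof. by move=> le_ij; apply/rank_step_decr/leq_sub2l. Qed.

End Controllability.

(** * Passage from Yokoyama coordinates to the original ones *)

Section Yokoyama.
Variables (F : fieldType) (n r l nu : nat).
Variables (A : 'M[F]_n) (B : 'M[F]_(n, r)) (C : 'M[F]_(l, n)).
Variable (e : (\sum_(i < nu) block_size A B i)%N = n).

(** Makes a minor of [C_tilde] the full determinant attached to the square system with outputs
    [rowsub f C], as [companion_minor] expects. *)
Lemma rowsub_C_tilde N (f : 'I_r -> 'I_l) :
  rowsub f (C_tilde C e N) =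
  \sum_(i < nu) 'X^i *: map_mx polyC
    (lpad_mx r (submxrow (castmx (erefl r, esym e) (rowsub f C *m invmx N)) i)).
Proof.
apply/matrixP => a b; rewrite mxE !summxE; apply: eq_bigr => i _.
rewrite !mxE; congr (_ * (_)%:P); rewrite /C_block.
(* Every step is at most step 0, which is [\rank B], so the padding to [r] columns is genuine. *)
have /lpad_mxE le_ir : (block_size A B i <= r)%N.
  apply: leq_trans (rank_leq_col B); exact: (rank_step_decr A B (leq0n _)).
rewrite !le_ir !mxE; apply: eq_bigr => k _; congr (_ * _).
rewrite !mxE !castmxE /= !cast_ord_id !mxE.
by apply: eq_bigr => c _; rewrite mxE.
Qed.

(** Multiplying by diag(N, I) on the left and diag(N^-1, M) on the right brings the pencil to
    Yokoyama coordinates; det N cancels and det M remains. *)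
Lemma yokoyama_minor (N : 'M[F]_n) (M : 'M[F]_r) (f : 'I_r -> 'I_l) :
    (0 < nu)%N -> \rank B = r -> yokoyama_form e N M ->
  (\det M)%:P * \det (block_mx ('X%:M - map_mx polyC A) (- map_mx polyC B)
                               (map_mx polyC (rowsub f C)) 0) * 'X^(r * nu)
  = 'X^n * \det (rowsub f (C_tilde C e N)).
Proof.
move=> nu_gt0 rkB [N_unit _ A_blocks [G [G_trig G_diag defG]]].
have detG : \det G = 1 by rewrite det_trig // big1.
rewrite rowsub_C_tilde; case: nu e nu_gt0 A_blocks => // nu' e' _ A_blocks.
have eq_r : block_size A B (ord_max : 'I_nu'.+1) = r.
  by rewrite /block_size subnn.
rewrite -(companion_minor (rowsub f C *m invmx N) (@block_size_mono _ _ _ A B _)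
            eq_r A_blocks detG).
congr (_ * _); rewrite -defG.
have detN : \det (map_mx polyC N) * \det (map_mx polyC (invmx N)) = 1.
  by rewrite -det_mulmx -map_mxM mulmxV // map_mx1 det1.
rewrite -[LHS]mul1r -detN mulrA mulrAC -!mulrA.
set P := block_mx _ _ _ _; set Q := block_mx _ _ _ _.
pose TN := block_mx (map_mx polyC N) 0 0 (1%:M : 'M_r).
pose TNM := block_mx (map_mx polyC (invmx N)) 0 0 (map_mx polyC M).
have -> : Q = TN *m P *m TNM.
  rewrite !mulmx_block !(mulmx0, mul0mx, addr0, add0r, mul1mx).
  rewrite /Q !map_mxM mulmxN mulNmx; congr block_mx.
  rewrite mulmxBr mulmxBl scalar_mxC -[in RHS](mulmxA 'X%:M).
  by rewrite -[map_mx _ N *m map_mx _ (invmx N)]map_mxM mulmxV // map_mx1 mulmx1.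
by rewrite !det_mulmx !det_ublock det1 mulr1
  [\det (map_mx _ M)]det_map_mx; ring.
Qed.

End Yokoyama.

(** * Schur complement of the system matrix *)

Section SchurComplement.
Variables (K : fieldType) (n r l : nat) (Q : 'M[K]_n) (B : 'M[K]_(n, r)).
Hypothesis Q_unit : Q \in unitmx.

Let U : 'M[K]_(n + r) := block_mx 1%:M (invmx Q *m B) 0 1%:M.

Let mulU l' (C : 'M[K]_(l', n)) :
  block_mx Q (- B) C 0 *m U = block_mx Q 0 C (C *m invmx Q *m B).
Proof.
rewrite mulmx_block !mulmx0 !mulmx1 !addr0 !mulmxA mulmxV // mul1mx.
by rewrite addrN.
Qed.

Let detU : \det U = 1.
Proof. by rewrite det_ublock !det1 mulr1. Qed.

(** Block elimination leaves diag(Q, C Q^-1 B). For Q = sI - A, normal rank n + r thus means full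
    column rank of the transfer matrix. *)
Lemma rank_block_schur (C : 'M[K]_(l, n)) :
  \rank (block_mx Q (- B) C 0) = (n + \rank (C *m invmx Q *m B))%N.
Proof.
pose L : 'M[K]_(n + l) := block_mx 1%:M 0 (- (C *m invmx Q)) 1%:M.
have U_full : row_free U by rewrite row_free_unit unitmxE detU unitr1.
have L_full : row_full L.
  by rewrite row_full_unit unitmxE det_lblock !det1 mulr1 unitr1.
rewrite -(mxrankMfree _ U_full) mulU -(eqmxMfull _ L_full) mulmx_block.
rewrite !mulmx0 !mul0mx !mul1mx addr0 add0r mulNmx mulmxKV // addNr ?addr0 ?add0r.
by rewrite rank_diag_block_mx mxrank_unit.
Qed.

Lemma det_block_schur (C : 'M[K]_(r, n)) :
  \det (block_mx Q (- B) C 0) = \det Q * \det (C *m invmx Q *m B).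
Proof. by rewrite -[LHS]mulr1 -detU -det_mulmx mulU det_lblock. Qed.

End SchurComplement.

(** * Largest order of the nonzero system minors *)

Section SystemMinors.
Variables (F : fieldType) (n r l : nat).
Variables (A : 'M[F]_n) (B : 'M[F]_(n, r)) (C : 'M[F]_(l, n)).

Lemma incr_ffun_id : incr_ffun [ffun i : 'I_r => i].
Proof. by apply/forallP => i; apply/forallP => j; rewrite !ffunE implybb. Qed.

(** An increasing self-map stays at or above the identity, and an excess at one index would
    propagate upwards until it leaves the range. Hence all [r] inputs can be selected in only one
    way. *)
Lemma incr_ffun_endo (g : {ffun 'I_r -> 'I_r}) :
  incr_ffun g -> g = [ffun i => i].
Proof.
move=> /forallP g_incr; apply/ffunP => i; rewrite ffunE; apply/val_inj/eqP => /=.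
have g_lt (a b : 'I_r) : (a < b)%N -> (g a < g b)%N by apply/implyP/(forallP (g_incr a)).
rewrite eqn_leq; apply/andP; split; last first.
  case: i => i lt_i /=; elim: i lt_i => // i IHi lt_i.
  exact: leq_ltn_trans (IHi (ltnW lt_i)) (g_lt (Ordinal (ltnW lt_i)) _ _).
rewrite leqNgt; apply/negP => lt_ig.
have: forall d (j : 'I_r), (r - j <= d)%N -> (j < g j)%N -> False.
  elim=> [|d IHd] j le_d lt_j.
    by move: le_d; rewrite leqn0 subn_eq0 leqNgt ltn_ord.
  have lt_j1 : (j.+1 < r)%N by apply: leq_ltn_trans lt_j (ltn_ord _).
  apply: (IHd (Ordinal lt_j1)) => /=; first lia.
  by apply: leq_ltn_trans lt_j (g_lt _ _ _).
by move/(_ _ i (leqnn _) lt_ig).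
Qed.

Lemma extend_index_l k m (f : {ffun 'I_k -> 'I_m}) (i : 'I_n) :
  extend_index f (lshift k i) = lshift m i.
Proof. by rewrite /extend_index -[lshift k i]/(unsplit (inl i)) unsplitK. Qed.

Lemma extend_index_r k m (f : {ffun 'I_k -> 'I_m}) (i : 'I_k) :
  extend_index f (rshift n i) = rshift n (f i).
Proof. by rewrite /extend_index -[rshift n i]/(unsplit (inr i)) unsplitK. Qed.

Lemma system_minor_id (f : {ffun 'I_r -> 'I_l}) :
  system_minor A B C f [ffun i => i]
  = \det (block_mx ('X%:M - map_mx polyC A) (- map_mx polyC B)
                   (map_mx polyC (rowsub f C)) 0).
Proof.
congr (\det _); apply/matrixP => a b; rewrite mxE /system_matrix.
case: (split_ordP a) => i ->; case: (split_ordP b) => j ->;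
  rewrite ?(extend_index_l, extend_index_r) ?ffunE.
- by rewrite !block_mxEul.
- by rewrite !block_mxEur.
- by rewrite !block_mxEdl !mxE.
- by rewrite !block_mxEdr !mxE.
Qed.

Lemma incr_rowsub_unit (K : fieldType) (T : 'M[K]_(l, r)) :
  row_full T -> exists2 f : {ffun 'I_r -> 'I_l}, incr_ffun f & rowsub f T \in unitmx.
Proof.
move=> T_full; pose S := [set fullrankfun T_full i | i : 'I_r].
have cardS : #|S| = r by rewrite card_imset ?card_ord //; apply: fullrankfun_inj.
(* [fullrankfun] gives independent rows in no particular order; listing its image increasingly keeps
   the row span. *)
pose f := [ffun i : 'I_r => Order.enum_val (cast_ord (esym cardS) i) : 'I_l].
exists f.
  apply/forallP => i; apply/forallP => j; apply/implyP => lt_ij.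
  have enum_mono (x y : 'I_#|S|) :
      (Order.enum_val x <= (Order.enum_val y : 'I_l))%N = (x <= y)%N.
    exact: (Order.EnumVal.le_enum_val (@le_total _ 'I_l) x y).
  by rewrite !ffunE ltnNge enum_mono -ltnNge.
have inS i : fullrankfun T_full i \in S by apply: imset_f.
rewrite -row_full_unit -sub1mx; apply: submx_trans (_ : (rowsub (fullrankfun T_full) T <= _)%MS).
  by rewrite sub1mx fullrowsub_full.
apply/row_subP => i; rewrite row_rowsub.
pose k := cast_ord cardS (Order.enum_rank_in (inS i) (fullrankfun T_full i)).
have -> : fullrankfun T_full i = f k.
  by rewrite [RHS]ffunE /k cast_ordK Order.EnumVal.enum_rankK_in.
by rewrite -row_rowsub row_sub.
Qed.

Lemma det_X_sub_neq0 : \det ('X%:M - map_mx polyC A) != 0.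
Proof. exact/monic_neq0/char_poly_monic. Qed.

(** Over F(s) the transfer matrix has full column rank, so some [r] of its rows form an invertible
    matrix; the Schur formula turns them into a nonzero minor using all inputs. *)
Lemma has_system_minor_max :
  normal_rank (system_matrix A B C) = (n + r)%N -> has_system_minor A B C r.
Proof.
rewrite /normal_rank map_block_mx map_mxN map_mx0.
set Q := map_mx _ ('X%:M - _).
have Q_unit : Q \in unitmx.
  by rewrite unitmxE det_map_mx unitfE tofrac_eq0 det_X_sub_neq0.
rewrite rank_block_schur // => /addnI rkT.
have [f f_incr Tf_unit] := incr_rowsub_unit (introT eqP rkT).
apply/existsP; exists f; apply/existsP; exists [ffun i => i].
rewrite f_incr incr_ffun_id /= system_minor_id.
set P := block_mx _ _ _ _.
suff: \det (map_mx (@tofrac {poly F}) P) != 0 by rewrite det_map_mx tofrac_eq0.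
have -> : map_mx (@tofrac {poly F}) P =
    block_mx Q (- map_mx (@tofrac {poly F}) (map_mx polyC B))
             (rowsub f (map_mx (@tofrac {poly F}) (map_mx polyC C))) 0.
  rewrite map_block_mx map_mxN map_mx0; congr block_mx.
  by apply/matrixP => a b; rewrite !mxE.
rewrite (det_block_schur _ Q_unit).
apply: mulf_neq0; first by move: Q_unit; rewrite unitmxE unitfE.
rewrite !mul_rowsub_mx.
by move: Tf_unit; rewrite unitmxE unitfE.
Qed.

Lemma max_minor_orderE : (r <= l)%N ->
  normal_rank (system_matrix A B C) = (n + r)%N -> max_minor_order A B C = r.
Proof.
move=> le_rl /has_system_minor_max has_r; apply/eqP; rewrite eqn_leq.
have minE : minn l r = r by apply/minn_idPr.
rewrite /max_minor_order minE; apply/andP; split.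
  by apply/bigmax_leqP => k _; rewrite -ltnS.
exact: (leq_bigmax_cond (Ordinal (ltnSn r))).
Qed.

End SystemMinors.

(** * Greatest common divisors and their zeros *)

Lemma dvdp_big_gcdp (F : fieldType) (I : finType) (P : pred I) (G : I -> {poly F})
    (d : {poly F}) :
  (d %| \big[@gcdp F/0]_(i | P i) G i) = [forall (i | P i), d %| G i].
Proof. by rewrite -big_andE (big_morph (dvdp d) (dvdp_gcd d) (dvdp0 d)). Qed.

Lemma eqp_mup (F : fieldType) (p q : {poly F}) (x : F) :
  p %= q -> mup x p = mup x q.
Proof.
have [-> | p0] := eqVneq p 0; first by rewrite eqp_sym eqp0 => /eqP ->.
move=> eq_pq; have q0 : q != 0 by apply: contraNneq p0 => q0; move: eq_pq; rewrite q0 eqp0.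
apply/eqP; rewrite eqn_leq !mup_geq //.
apply/andP; split; [rewrite -(eqp_dvdr _ eq_pq) | rewrite (eqp_dvdr _ eq_pq)];
  by rewrite -mup_geq.
Qed.

(** Gcds are fixed only up to a nonzero constant, which affects neither roots nor multiplicities. *)
Lemma eqp_same_zeros (R : realType) (p q : {poly R}) : p %= q -> same_zeros p q.
Proof.
move=> eq_pq z; have eq_map : map_poly (real_complex R) p %= map_poly (real_complex R) q.
  by rewrite eqp_map.
by split; [rewrite (eqp_root eq_map) | apply: eqp_mup].
Qed.

(** Both gcds have the same divisors: the column selection is forced to be the identity, and the
    nonzero factor [c] changes neither divisibility nor vanishing. *)
Lemma system_zero_polyE (F : fieldType) n r l (A : 'M[F]_n) (B : 'M[F]_(n, r))
    (C : 'M[F]_(l, n)) (c : F) (q : {ffun 'I_r -> 'I_l} -> {poly F}) :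
    max_minor_order A B C = r -> c != 0 ->
    (forall f, q f = c *: system_minor A B C f [ffun i => i]) ->
  system_zero_poly A B C
    %= \big[@gcdp F/0]_(f : {ffun 'I_r -> 'I_l} | incr_ffun f && (q f != 0)) q f.
Proof.
move=> max_r c0 qE; rewrite /system_zero_poly max_r.
have qP f : (q f == 0) = (system_minor A B C f [ffun i => i] == 0).
  by rewrite qE scaler_eq0 (negPf c0).
have dvd_q d f : (d %| q f) = (d %| system_minor A B C f [ffun i => i]).
  by rewrite qE dvdpZr.
apply/andP; split; rewrite dvdp_big_gcdp; apply/forall_inP.
  move=> f /andP[f_incr qf0]; rewrite dvd_q.
  have := dvdpp (system_zero_poly A B C).
  rewrite /system_zero_poly max_r dvdp_big_gcdp => /forall_inP/(_ (f, [ffun i => i])).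
  by apply; rewrite /= f_incr incr_ffun_id -qP.
case=> f g /= /and3P[f_incr /incr_ffun_endo -> m0]; rewrite -dvd_q.
have := dvdpp (\big[@gcdp F/0]_(f | incr_ffun f && (q f != 0)) q f).
by rewrite dvdp_big_gcdp => /forall_inP; apply; rewrite f_incr qP.
Qed.

Theorem theorem7p2 (R : realType) (n r l nu : nat)
    (A : 'M[R]_n) (B : 'M[R]_(n, r)) (C : 'M[R]_(l, n))
    (lt_rl : (r < l)%N)
    (rankB : \rank B = r)
    (ctrAB : controllable A B)
    (nuP : ctrb_index A B nu)
    (nrankP : normal_rank (system_matrix A B C) = (n + r)%N)
    (N : 'M[R]_n) (M : 'M[R]_r)
    (yokNM : yokoyama_form (sum_block_size ctrAB nuP) N M) :
  let Ct := C_tilde C (sum_block_size ctrAB nuP) N in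
  (* q f is s^(n - r nu) times the minor of Ct with rows f; the exponent is an
     integer, so this product is taken in the field of rational functions *)
  exists q : {ffun 'I_r -> 'I_l} -> {poly R},
    (forall f, incr_ffun f ->
       tofrac (q f) = tofrac 'X ^ (n%:Z - (r * nu)%:Z)
                      * tofrac (\det (rowsub f Ct)))
    /\ same_zeros (system_zero_poly A B C)
         (\big[@gcdp R/0]_(f : {ffun 'I_r -> 'I_l} | incr_ffun f && (q f != 0))
            q f).

Proof.
have [nu_gt0 _ _] := nuP; have [_ M_perm _ _] := yokNM; move=> Ct.
have detM : \det M != 0.
  have /is_perm_mxP[s ->] := M_perm.
  by rewrite det_perm signr_eq0.
(* By [yokoyama_minor] this is the polynomial that s^(n - r nu) det C~_f equals, even when the
   exponent is negative. *)
pose q (f : {ffun 'I_r -> 'I_l}) := \det M *: system_minor A B C f [ffun i => i].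
exists q; split=> [f _|].
  have X0 : @tofrac {poly R} 'X != 0 by rewrite tofrac_eq0 polyX_eq0.
  have minorE : q f * 'X^(r * nu) = 'X^n * \det (rowsub f Ct).
    rewrite /q -mul_polyC system_minor_id.
    exact: yokoyama_minor nu_gt0 rankB yokNM.
  (* Multiplying by s^(r nu) reduces the claim to the polynomial identity [minorE]. *)
  apply: (mulIf (expf_neq0 (r * nu) X0)).
  have := congr1 (@tofrac {poly R}) minorE; rewrite !rmorphM !rmorphXn => ->.
  by rewrite [RHS]mulrAC !exprnP -expfzDr // subrK.
apply/eqp_same_zeros/(system_zero_polyE _ detM) => //.
by apply: max_minor_orderE => //; apply: ltnW.
Qed.
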